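(* Let $m,n$ be co-prime positive integers and let $d\ge 1$ be an integer. Let $\overline D$ be any $(dm,dn)$-Dyck path and let $D$ be its sweep map image. Then $$\mathrm{dinv}(\overline D)=\mathrm{area}(D).$$
   Context: A $(dm,dn)$-Dyck path is a lattice path from $(0,0)$ to $(dm,dn)$ consisting of $dn$ unit North steps and $dm$ unit East steps that stays weakly above the main diagonal from $(0,0)$ to $(dm,dn)$ (slope $n/m$). Ranks: the rank of the origin is $0$; after each North step the rank increases by $m$, after each East step it decreases by $n$ (so the vertex $(x,y)$ has rank $my-nx$). The starting rank of a step is the rank of its starting vertex. A path from $(0,0)$ to $(dm,dn)$ is a Dyck path iff all its ranks are nonnegative. Sweep map: the sweep map image $D$ of $\overline D$ is the path whose sequence of steps (North/East) is obtained by rearranging the steps of $\overline D$ in increasing order of their starting ranks, where among steps with the same starting rank the one whose starting point is further to the right comes first. (The image $D$ is again a $(dm,dn)$-Dyck path.) Area: $\mathrm{area}(D)$ is the number of (whole) unit lattice cells lying between the path $D$ and the main diagonal. Dinv: a unit lattice cell $c$ of the rectangle $[0,dm]\times[0,dn]$ lying above the path $\overline D$ contributes one unit to $\mathrm{dinv}(\overline D)$ if and only if $0\le a-b<m+n$, where $a$ is the starting rank of the East step of $\overline D$ below $c$ (in the same column as $c$) and $b$ is the starting rank of the North step of $\overline D$ to the right of $c$ (in the same row as $c$). $\mathrm{dinv}(\overline D)$ is the number of contributing cells. *)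

(* Defs.v *)
From mathcomp Require Import all_boot all_order all_algebra.

Set Implicit Arguments.
Unset Strict Implicit.
Unset Printing Implicit Defensive.

Import Order.TTheory GRing.Theory Num.Theory.

(* A lattice path starting at the origin is encoded by its word of steps. *)
Definition lattice_path := seq bool.
Notation North := true (only parsing).
Notation East := false (only parsing).

Section Paths.

Variable w : lattice_path.

(* The step number k of w (counting from 0) starts at (vx k, vy k). *)
Definition vx (k : nat) : nat := count_mem East (take k w).
Definition vy (k : nat) : nat := count_mem North (take k w).

Definition is_step (s : bool) (k : nat) : bool :=
  (k < size w)%N && (nth North w k == s).

(* The number k of the East step in column i (i.e. with abscissae [i, i+1]) *)
(* and of the North step in row j (i.e. with ordinates [j, j+1]). Since     *)
(* find returns a position in iota 0 (size w), it returns k itself; when    *)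
(* there is no such step, the value is size w.                              *)
Definition east_step (i : nat) : nat :=
  find (fun k => is_step East k && (vx k == i)) (iota 0 (size w)).
Definition north_step (j : nat) : nat :=
  find (fun k => is_step North k && (vy k == j)) (iota 0 (size w)).

(* The cell (i, j) is the unit square [i, i+1] x [j, j+1]. *)
Definition cell_above (i j : nat) : bool := (vy (east_step i) <= j)%N.
Definition cell_below (i j : nat) : bool := (j < vy (east_step i))%N.

End Paths.

Section Rational.

Variables m n : nat.

Definition vrank (x y : nat) : int := (m%:Z * y%:Z - n%:Z * x%:Z)%R.

Definition srank (w : lattice_path) (k : nat) : int := vrank (vx w k) (vy w k).

(* The diagonal has slope n/m. *)
Definition weakly_above_diag (x y : nat) : bool := (n * x <= m * y)%N.

Definition is_dyck_path (d : nat) (w : lattice_path) : Prop :=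
  [/\ count_mem East w = (d * m)%N,
      count_mem North w = (d * n)%N
    & forall k, (k <= size w)%N -> weakly_above_diag (vx w k) (vy w k)].

(* Increasing starting rank, ties being read from right to left. Distinct   *)
(* vertices of equal rank have distinct abscissae (when m, n > 0), so this  *)
(* is a total order on the steps of w.                                      *)
Definition sweep_le (w : lattice_path) (k l : nat) : bool :=
  (srank w k < srank w l)%R
  || (srank w k == srank w l) && (vx w l <= vx w k)%N.

Definition sweep (w : lattice_path) : lattice_path :=
  [seq nth North w k | k <- sort (sweep_le w) (iota 0 (size w))].

(* A cell lies entirely above the diagonal iff its bottom right corner does. *)
Definition area (d : nat) (w : lattice_path) : nat :=
  #|[set c : 'I_(d * m) * 'I_(d * n) |
      cell_below w c.1 c.2 && weakly_above_diag c.1.+1 c.2]|.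

Definition dinv (d : nat) (w : lattice_path) : nat :=
  #|[set c : 'I_(d * m) * 'I_(d * n) |
      cell_above w c.1 c.2 &&
      (0 <= srank w (east_step w c.1) - srank w (north_step w c.2)
         < (m + n)%:Z)%R]|.

End Rational.

(* Main.v *)
(** Index the cells of both paths by pairs (East step [k], North step [l]) of
    the path [w].  Since the image [D] of [w] is a Dyck path, [area D] is the
    number of pairs in which [l] precedes [k] in the sweep order, minus the
    number of cells that are not above the diagonal.  Comparing pair by pair,
    [l] precedes [k] in the sweep order exactly when the pair contributes to
    [dinv w] or is bad: either [k < l] and the rank of [k] exceeds that of [l]
    by at least [m + n], or [l < k] and the rank of [k] exceeds that of [l].
    So it suffices that the number of bad pairs depends only on [m], [n], [d].
    Replacing a factor East North of [w] by North East changes the number of bad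
    pairs by a difference of up- and down-crossings of two horizontal levels,
    one after the factor and one before it, which cancel because the ranks are
    nonnegative.  Such moves lead to the path N^(dn) E^(dm), whose bad pairs are
    the cells that are not above the diagonal. *)
Require Import Defs.
From mathcomp Require Import all_boot all_order all_algebra.
From mathcomp Require Import zify.

Set Implicit Arguments.
Unset Strict Implicit.
Unset Printing Implicit Defensive.

Import Order.TTheory GRing.Theory Num.Theory.

(** * Counting as double sums *)

Lemma count_nth (T : Type) (x0 : T) (a : pred T) (L : seq T) :
  count a L = \sum_(0 <= j < size L) a (nth x0 L j).
Proof. by rewrite -sum1_count big_mkcond (big_nth x0); apply: eq_bigr => j _; case: ifP. Qed.

Lemma card_set_pair (a b : nat) (P : nat -> nat -> bool) :
  #|[set c : 'I_a * 'I_b | P c.1 c.2]| =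
  \sum_(i <- iota 0 a) \sum_(j <- iota 0 b) P i j.
Proof.
rewrite cardsE -sum1_card big_mkcond /=.
rewrite -(pair_bigA _ (fun i j => if (i, j) \in [pred c : 'I_a * 'I_b | P c.1 c.2] then 1 else 0)) /=.
have -> : iota 0 a = index_iota 0 a by rewrite /index_iota subn0.
have -> : iota 0 b = index_iota 0 b by rewrite /index_iota subn0.
rewrite big_mkord; apply: eq_bigr => i _.
rewrite big_mkord; apply: eq_bigr => j _.
by rewrite inE /=; case: (P i j).
Qed.

(** * Steps of one direction and their coordinates *)

Section StepNumbering.

Variables (w : seq bool) (s : bool).

(** For [s] East or North this is [vx] or [vy], and [step_number] is [east_step] or [north_step], by
    conversion; both directions share one proof. *)
Definition coord (k : nat) : nat := count_mem s (take k w).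

Definition step_number (i : nat) : nat :=
  find (fun k => is_step w s k && (coord k == i)) (iota 0 (size w)).

Lemma coordS k : k < size w -> coord k.+1 = coord k + (nth true w k == s).
Proof.
by move=> kw; rewrite /coord (take_nth true kw) -cats1 count_cat /= addn0.
Qed.

Lemma leq_coord k l : k <= l -> coord k <= coord l.
Proof.
by move=> kl; rewrite /coord -(subnKC kl) takeD count_cat leq_addr.
Qed.

Lemma coord_inj k l : is_step w s k -> is_step w s l -> coord k = coord l -> k = l.
Proof.
move=> /andP[kw /eqP sk] /andP[lw /eqP sl] e.
have := coordS kw; have := coordS lw; rewrite sk sl eqxx => el ek.
case: (ltngtP k l) => // kl; have := leq_coord kl; lia.
Qed.

(** Each column or row is crossed by exactly one step of its direction, so sums over cells become
    sums over pairs of steps. *)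
Lemma map_coord :
  [seq coord k | k <- iota 0 (size w) & is_step w s k] = iota 0 (count_mem s w).
Proof.
suff H p : p <= size w ->
  [seq coord k | k <- iota 0 p & is_step w s k] = iota 0 (coord p).
  by rewrite H // /coord take_size.
elim: p => [|p IHp] pw; first by rewrite /coord take0.
rewrite coordS // iotaD -[p.+1]addn1 iotaD filter_cat map_cat IHp 1?ltnW //=.
by rewrite add0n /is_step pw /=; case: eqP.
Qed.

Lemma coordK k : is_step w s k -> step_number (coord k) = k.
Proof.
move=> sk; have /andP[kw _] := sk.
pose P l := is_step w s l && (coord l == coord k).
have hasP : has P (iota 0 (size w)).
  by apply/hasP; exists k; rewrite ?mem_iota // /P sk eqxx.
have /andP[sf /eqP ef] := nth_find 0 hasP.
have fw : find P (iota 0 (size w)) < size w by rewrite -{2}(size_iota 0 (size w)) -has_find.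
move: (coord_inj sf sk ef); rewrite nth_iota //.
Qed.

Lemma sum_coord (f : nat -> nat) :
  \sum_(i <- iota 0 (count_mem s w)) f i =
  \sum_(k <- iota 0 (size w) | is_step w s k) f (coord k).
Proof. by rewrite -map_coord big_map big_filter. Qed.

End StepNumbering.

Lemma vx_add_vy (w : seq bool) k : k <= size w -> vx w k + vy w k = k.
Proof.
move=> kw; rewrite /vx /vy -[RHS](size_takel kw).
by elim: (take k w) => //= -[] u /=; lia.
Qed.

Lemma sum_cells (w : seq bool) (R : nat -> nat -> bool) :
  \sum_(i <- iota 0 (count_mem false w)) \sum_(j <- iota 0 (count_mem true w)) R i j =
  \sum_(k <- iota 0 (size w) | is_step w false k)
     \sum_(l <- iota 0 (size w) | is_step w true l) R (vx w k) (vy w l).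
Proof.
rewrite sum_coord; apply: eq_bigr => k _.
by rewrite sum_coord.
Qed.

(** A North step [l] before [k] makes [vy w k] strictly larger. Hence a cell is above the path when
    its East step precedes its North step. *)
Lemma vy_leq_steps (w : seq bool) k l :
  is_step w false k -> is_step w true l -> (vy w k <= vy w l) = (k < l).
Proof.
move=> /andP[kw /eqP sk] /andP[lw /eqP sl].
have := @coordS w true k kw; have := @coordS w true l lw.
rewrite sk sl /= -/(vy w _) => el ek.
have kl : k != l by apply/eqP => e; move: sk; rewrite e sl.
case: (ltngtP k l) kl => // kl _; have := leq_coord w true kl;
  rewrite /coord -/(vy w _) -/(vy w _); move: el ek; rewrite /coord -!/(vy w _); lia.
Qed.

Lemma is_stepP (w : seq bool) s k : is_step w s k -> k < size w /\ nth true w k = s.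
Proof. by move=> /andP[kw /eqP]. Qed.

(** * Factors East North of a word *)

(** Termination measure: replacing a factor East North by North East lowers it by one. *)
Fixpoint inversions (w : seq bool) : nat :=
  if w is s :: w' then (if s then 0 else count_mem true w') + inversions w' else 0.

Lemma sorted_or_descent (w : seq bool) :
  w = nseq (count_mem true w) true ++ nseq (count_mem false w) false \/
  exists u v, w = u ++ [:: false, true & v].
Proof.
elim: w => [|[] w [e|[u [v ->]]]]; first by left.
- by left; rewrite {1}e.
- by right; exists (true :: u), v.
- case ea: (count_mem true w) e => [|a] e; first by left; rewrite /= ea {1}e.
  by right; exists [::], (nseq a true ++ nseq (count_mem false w) false); rewrite {1}e.
- by right; exists (false :: u), v.
Qed.

Section Ranks.

Variables m n : nat.

(** * Dinv and area as sums over pairs of steps *)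

Lemma dinvE d w : is_dyck_path m n d w ->
  dinv m n d w =
  \sum_(k <- iota 0 (size w) | is_step w false k)
    \sum_(l <- iota 0 (size w) | is_step w true l)
      ((k < l) && (0 <= srank m n w k - srank m n w l < (m + n)%:Z)%R).
Proof.
move=> [cE cN _]; rewrite /dinv (card_set_pair _ _ (fun i j => cell_above w i j &&
  (0 <= srank m n w (east_step w i) - srank m n w (north_step w j) < (m + n)%:Z)%R)).
rewrite -cE -cN sum_coord; apply: eq_bigr => k sk.
rewrite sum_coord; apply: eq_bigr => l sl.
rewrite /cell_above.
have -> : east_step w (coord w false k) = k by exact: coordK.
have -> : north_step w (coord w true l) = l by exact: coordK.
by rewrite vy_leq_steps.
Qed.

Definition cells_off d :=
  \sum_(i <- iota 0 (d * m)) \sum_(j <- iota 0 (d * n)) ~~ weakly_above_diag m n i.+1 j.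

(** A cell above a Dyck path is above the diagonal, so all cells counted by [cells_off] lie below
    the path and complete its area. *)
Lemma areaE d w : is_dyck_path m n d w ->
  area m n d w + cells_off d =
  \sum_(k <- iota 0 (size w) | is_step w false k)
    \sum_(l <- iota 0 (size w) | is_step w true l) (l < k).
Proof.
move=> [cE cN dyck]; rewrite /area (card_set_pair _ _ (fun i j => cell_below w i j &&
  weakly_above_diag m n i.+1 j)) /cells_off.
rewrite -cE -cN !sum_coord -big_split /=; apply: eq_bigr => k sk.
rewrite !sum_coord -big_split /=; apply: eq_bigr => l sl.
rewrite /cell_below.
have -> : east_step w (coord w false k) = k by exact: coordK.
rewrite ltnNge vy_leq_steps //.
have kl : k != l.
  by apply/eqP => e; have [_ h1] := is_stepP sk; have [_] := is_stepP sl; rewrite -e h1.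
rewrite -leqNgt leq_eqVlt eq_sym (negbTE kl) /=.
case: (ltnP l k) => [_|lk]; first by case: weakly_above_diag.
suff -> : weakly_above_diag m n (coord w false k).+1 (coord w true l) by [].
have [kw nk] := is_stepP sk.
have := dyck k.+1 kw; rewrite /weakly_above_diag.
have -> : vx w k.+1 = (coord w false k).+1.
  by rewrite /vx -/(coord w false k.+1) coordS // nk addn1.
move=> /leq_trans; apply; rewrite leq_mul2l; apply/orP; right.
by apply: leq_coord; rewrite ltn_neqAle kl.
Qed.

(** * Ranks and the sweep order *)

Lemma srankS w k : k < size w ->
  srank m n w k.+1 = (srank m n w k + (if nth true w k then m%:Z else - n%:Z))%R.
Proof.
move=> kw; rewrite /srank /vrank /vx /vy.
have := @coordS w true k kw; have := @coordS w false k kw; rewrite /coord => -> ->.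
case: (nth true w k) => /=; lia.
Qed.

Lemma srank_size d w : is_dyck_path m n d w -> srank m n w (size w) = 0%R.
Proof.
move=> [cE cN _]; rewrite /srank /vrank /vx /vy take_size.
rewrite cE cN; lia.
Qed.

(** Between vertices of equal rank, [m] times the rise is [n] times the run, so the later vertex is
    strictly to the right: ties in the sweep go to the later step. *)
Lemma vx_srank_inj w k l : 0 < m -> k <= size w -> l <= size w ->
  srank m n w k = srank m n w l -> (vx w l <= vx w k) = (l <= k).
Proof.
move=> m_gt0 kw lw; have := vx_add_vy kw; have := vx_add_vy lw.
rewrite /srank /vrank => el ek er.
case: (leqP l k) => lk; first by have := leq_coord w false lk; rewrite /coord -!/(vx _ _).
have := leq_coord w true (ltnW lk); rewrite /coord -!/(vy _ _) => yy.
have := leq_coord w false (ltnW lk); rewrite /coord -!/(vx _ _) => xx.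
apply/negbTE; rewrite -ltnNge; nia.
Qed.

Lemma sweep_leE w k l : 0 < m -> k <= size w -> l <= size w ->
  sweep_le m n w k l =
  (srank m n w k < srank m n w l)%R || (srank m n w k == srank m n w l) && (l <= k).
Proof.
move=> m_gt0 kw lw; rewrite /sweep_le; case: (eqVneq (srank m n w k)) => // e.
by rewrite (vx_srank_inj m_gt0 kw lw e).
Qed.

Definition sweep_order w := sort (sweep_le m n w) (iota 0 (size w)).

Lemma sweep_le_trans w : transitive (sweep_le m n w).
Proof. move=> y x z; rewrite /sweep_le; lia. Qed.

Lemma sweep_le_total w : total (sweep_le m n w).
Proof. move=> x y; rewrite /sweep_le; lia. Qed.

Lemma perm_sweep_order w : perm_eq (sweep_order w) (iota 0 (size w)).
Proof. by rewrite perm_sort. Qed.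

Lemma size_sweep_order w : size (sweep_order w) = size w.
Proof. by rewrite size_sort size_iota. Qed.

Lemma mem_sweep_order w k : (k \in sweep_order w) = (k < size w).
Proof. by rewrite mem_sort mem_iota. Qed.

Lemma sweepE w : sweep m n w = [seq nth true w k | k <- sweep_order w].
Proof. by []. Qed.

Lemma size_sweep w : size (sweep m n w) = size w.
Proof. by rewrite sweepE size_map size_sweep_order. Qed.

Lemma count_sweep w s : count_mem s (sweep m n w) = count_mem s w.
Proof.
rewrite sweepE -[in RHS](mkseq_nth true w) /mkseq.
by have /permP -> := perm_map (nth true w) (perm_sweep_order w).
Qed.

(** Position [i] of the image carries step [nth 0 (sweep_order w) i] of [w]; both sums are renamed
    along this permutation. *)
Lemma sweep_inversions w : 0 < m ->
  \sum_(k <- iota 0 (size (sweep m n w)) | is_step (sweep m n w) false k)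
    \sum_(l <- iota 0 (size (sweep m n w)) | is_step (sweep m n w) true l) (l < k) =
  \sum_(k <- iota 0 (size w) | is_step w false k)
    \sum_(l <- iota 0 (size w) | is_step w true l) sweep_le m n w l k.
Proof.
move=> m_gt0; rewrite size_sweep -[RHS](perm_big _ (perm_sweep_order w)) /=.
have e0 : iota 0 (size w) = index_iota 0 (size w) by rewrite /index_iota subn0.
have stepE s k : k < size w ->
  is_step (sweep m n w) s k = is_step w s (nth 0 (sweep_order w) k).
  move=> kw; rewrite /is_step size_sweep kw.
  rewrite -mem_sweep_order mem_nth ?size_sweep_order //=.
  by rewrite sweepE (nth_map 0) ?size_sweep_order.
rewrite [RHS](big_nth 0) size_sweep_order e0 [LHS]big_nat_cond [RHS]big_nat_cond.
apply: eq_big => k; first by case: ltnP => // kw; rewrite stepE.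
move=> /andP[/= kw sk].
rewrite -[in RHS]e0 -[RHS](perm_big _ (perm_sweep_order w)) /=.
rewrite [RHS](big_nth 0) size_sweep_order [LHS]big_nat_cond [RHS]big_nat_cond.
apply: eq_big => l; first by case: ltnP => // lw; rewrite stepE.
move=> /andP[/= lw sl].
congr nat_of_bool.
rewrite stepE // in sk; rewrite stepE // in sl.
have srt : sorted (sweep_le m n w) (sweep_order w) by apply/sort_sorted/sweep_le_total.
have lt_le i j : i < j -> j < size w ->
  sweep_le m n w (nth 0 (sweep_order w) i) (nth 0 (sweep_order w) j).
  move=> ij jw; apply: (sorted_ltn_nth (@sweep_le_trans w)) => //.
    by rewrite inE size_sweep_order (ltn_trans ij).
  by rewrite inE size_sweep_order.
have nkl : nth 0 (sweep_order w) k != nth 0 (sweep_order w) l.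
  apply/eqP => e; have [_ h1] := is_stepP sk.
  by have [_] := is_stepP sl; rewrite -e h1.
case: (ltngtP l k) => [lk|kl|e]; first by rewrite lt_le.
  (* With ties decided by position, distinct steps cannot compare both ways. *)
  have := lt_le _ _ kl lw.
  have [/ltnW kw' _] := is_stepP sk; have [/ltnW lw' _] := is_stepP sl.
  rewrite !sweep_leE //; move: nkl; lia.
by rewrite e eqxx in nkl.
Qed.


(** * Nonnegative ranks of the sweep image *)

Definition rise (s : bool) : int := (if s then m%:Z else - n%:Z)%R.

Definition height (u : seq bool) : int := (\sum_(x <- u) rise x)%R.

Lemma heightE u : height u = vrank m n (count_mem false u) (count_mem true u).
Proof.
rewrite /height /vrank; elim: u => [|[] u IHu]; rewrite ?big_nil ?big_cons ?IHu /=; lia.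
Qed.

Lemma srank_height w k : srank m n w k = height (take k w).
Proof. by rewrite heightE. Qed.

Lemma height_cat u v : height (u ++ v) = (height u + height v)%R.
Proof. exact: big_cat. Qed.

Lemma height_cons s u : height (s :: u) = (rise s + height u)%R.
Proof. exact: big_cons. Qed.

Lemma height_nil : height [::] = 0%R.
Proof. exact: big_nil. Qed.

(* The sum over all steps of the increments of the rank truncated at the level
   of the first step after the prefix is zero; the truncated increments are
   nonpositive off the prefix and below the true ones on the prefix. *)
Lemma sweep_srank_ge0 w k : height w = 0%R -> (0 <= srank m n (sweep m n w) k)%R.
Proof.
move=> hw; rewrite srank_height.
case: (ltnP k (size w)) => [kw|wk]; last first.
  rewrite take_oversize ?size_sweep // heightE.
  by rewrite !count_sweep -heightE hw.
pose s := sweep_order w; pose a := srank m n w (nth 0 s k).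
pose incr x : int := (Num.min (srank m n w x.+1) a - Num.min (srank m n w x) a)%R.
have sum0 : (\sum_(x <- s) incr x = 0)%R.
  rewrite (perm_big _ (perm_sweep_order w)) /= -[in iota _ _](subn0 (size w)).
  rewrite telescope_sumr // !srank_height take0 take_size hw.
  by rewrite height_nil subrr.
have srt : sorted (sweep_le m n w) s by apply/sort_sorted/sweep_le_total.
have nth_le i j : i <= j -> j < size w ->
    (srank m n w (nth 0%N s i) <= srank m n w (nth 0%N s j))%R.
  move=> ij jw.
  have := sorted_leq_nth (@sweep_le_trans w) _ 0 srt.
  move=> /(_ _ i j); rewrite !inE size_sweep_order (leq_ltn_trans ij jw) jw ij.
  have refl : reflexive (sweep_le m n w) by move=> x; rewrite /sweep_le; lia.
  by move=> /(_ refl isT isT isT); rewrite /sweep_le; lia.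
have incr_srank x : x \in s -> srank m n w x.+1 = (srank m n w x + rise (nth true w x))%R.
  by rewrite mem_sweep_order => xw; rewrite srankS.
have incr_drop : (\sum_(x <- drop k s) incr x <= 0)%R.
  rewrite big_seq; apply: sumr_le0 => x /(nthP 0)[i]; rewrite size_drop size_sweep_order.
  move=> ik <-; rewrite nth_drop /incr.
  have ax : (a <= srank m n w (nth 0%N s (k + i)))%R by apply: nth_le; lia.
  by rewrite (min_r ax) subr_le0 ge_min lexx orbT.
have incr_take : (\sum_(x <- take k s) incr x <= \sum_(x <- take k s) rise (nth true w x))%R.
  rewrite big_seq [leRHS]big_seq; apply: ler_sum => x xk.
  have xs := mem_take xk; have := incr_srank x xs; rewrite /incr => ->.
  move: xk => /(nthP 0)[i]; rewrite size_take_min size_sweep_order => ik <-.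
  rewrite nth_take; last by lia.
  have ax : (srank m n w (nth 0%N s i) <= a)%R by apply: nth_le; lia.
  by rewrite (min_l ax) lerBlDl ge_min lexx.
rewrite sweepE /height -map_take big_map -/s.
apply: le_trans incr_take; rewrite -[leLHS]sum0 -{1}(cat_take_drop k s) big_cat /=.
by rewrite gerDl.
Qed.

(** * Bad pairs and level crossings *)

Fixpoint labels (r : int) (w : seq bool) : seq (bool * int) :=
  if w is s :: w' then (s, r) :: labels (r + rise s)%R w' else [::].

Lemma labels_cat r u v : labels r (u ++ v) = labels r u ++ labels (r + height u)%R v.
Proof.
elim: u r => [|s u IHu] r /=; first by rewrite height_nil addr0.
by rewrite IHu height_cons addrA.
Qed.

Lemma size_labels r w : size (labels r w) = size w.
Proof. by elim: w r => //= s w IHw r; rewrite IHw. Qed.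

Lemma nth_labels x0 r w k : k < size w ->
  nth x0 (labels r w) k = (nth true w k, (r + srank m n w k)%R).
Proof.
elim: w r k => [|s w IHw] r [|k] //= kw; rewrite srank_height.
  by rewrite height_nil addr0.
by rewrite IHw // srank_height /= height_cons addrA.
Qed.

(* The step [x] comes before [y]; in the first case the condition compares the
   end ranks [r - n] and [r' + m]. *)
Definition bad_pair (x y : bool * int) : bool :=
  match x, y with
  | (false, r), (true, r') => (r' + (m + n)%:Z <= r)%R
  | (true, r), (false, r') => (r < r')%R
  | _, _ => false
  end.

Fixpoint bad_pairs (L : seq (bool * int)) : nat :=
  if L is x :: L' then count (bad_pair x) L' + bad_pairs L' else 0.

(* Crossings of the level between the ranks [t] and [t + 1]. *)
Definition ups (t : int) (L : seq (bool * int)) : nat :=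
  count (fun x => x.1 && (x.2 <= t < x.2 + m%:Z)%R) L.

Definition downs (t : int) (L : seq (bool * int)) : nat :=
  count (fun x => ~~ x.1 && (x.2 - n%:Z <= t < x.2)%R) L.

(** Up- and down-crossings of a level alternate, so their numbers differ only through the sides on
    which the path starts and ends. *)
Lemma crossings t r w :
  ups t (labels r w) + (t < r)%R = downs t (labels r w) + (t < r + height w)%R.
Proof.
elim: w r => [|s w IHw] r; first by rewrite height_nil addr0.
have := IHw (r + rise s)%R; rewrite height_cons addrA /ups /downs /=.
by case: s; rewrite /rise /=; lia.
Qed.

(** A step of [A] is affected only if it crosses the level just below [r + m]: the exchange gives an
    up-crossing one more bad pair and a down-crossing one fewer. *)
Lemma bad_pairs_swap_prefix (A T : seq (bool * int)) (r : int) :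
  bad_pairs [:: (false, r), (true, r - n%:Z)%R & T] =
    bad_pairs [:: (true, r), (false, r + m%:Z)%R & T] ->
  bad_pairs (A ++ [:: (false, r), (true, r - n%:Z)%R & T]) + ups (r + m%:Z - 1)%R A =
  bad_pairs (A ++ [:: (true, r), (false, r + m%:Z)%R & T]) + downs (r + m%:Z - 1)%R A.
Proof.
move=> base; elim: A => [|x A IHA]; first by rewrite !cat0s base.
rewrite /= !count_cat /=; move: IHA; rewrite /ups /downs.
by case: x => -[] q /=; lia.
Qed.

(** For the tail the level is just above [r - n], with the same gains and losses. The tail starts
    above it and ends at 0, below it, a net loss of one; the exchanged pair itself becomes bad and
    makes up for it. *)
Lemma bad_pairs_swap_head (r : int) v : 0 < m ->
  (0 <= r - n%:Z)%R -> (r + m%:Z - n%:Z + height v = 0)%R ->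
  bad_pairs (labels r [:: false, true & v]) = bad_pairs (labels r [:: true, false & v]).
Proof.
move=> m_gt0 r0 hv; rewrite /= /rise.
have -> : (r - n%:Z + m%:Z = r + m%:Z - n%:Z)%R by lia.
set T := labels _ v.
have cr : ups (r - n%:Z)%R T + (r - n%:Z < r + m%:Z - n%:Z)%R =
          downs (r - n%:Z)%R T + (r - n%:Z < r + m%:Z - n%:Z + height v)%R.
  exact: crossings.
have countU : count (bad_pair (false, r + m%:Z)%R) T =
              count (bad_pair (false, r)) T + ups (r - n%:Z)%R T.
  by rewrite /ups; elim: T {cr} => //= -[[] q] T ->; rewrite /=; lia.
have countD : count (bad_pair (true, r - n%:Z)%R) T =
              count (bad_pair (true, r)) T + downs (r - n%:Z)%R T.
  by rewrite /downs; elim: T {cr countU} => //= -[[] q] T ->; rewrite /=; lia.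
rewrite countU countD; move: cr; rewrite hv; lia.
Qed.

Lemma bad_pairs_swap u v : 0 < m ->
  (0 <= height u - n%:Z)%R -> height (u ++ [:: false, true & v]) = 0%R ->
  bad_pairs (labels 0 (u ++ [:: false, true & v])) =
  bad_pairs (labels 0 (u ++ [:: true, false & v])).
Proof.
move=> m_gt0 u0 h0; rewrite !labels_cat add0r.
have e : bad_pairs (labels (height u) [:: false, true & v]) =
         bad_pairs (labels (height u) [:: true, false & v]).
  apply: bad_pairs_swap_head => //.
  by move: h0; rewrite height_cat !height_cons /rise; lia.
have := crossings (height u + m%:Z - 1)%R 0 u; rewrite add0r.
move: e; rewrite /= /rise.
have -> : (height u - n%:Z + m%:Z = height u + m%:Z - n%:Z)%R by lia.
move=> /bad_pairs_swap_prefix => /(_ (labels 0 u)).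
(* The prefix starts at 0 and ends at [height u], both below the level, so its crossings balance. *)
have -> : (height u + m%:Z - 1 < 0)%R = false by lia.
have -> : (height u + m%:Z - 1 < height u)%R = false by lia.
by rewrite !addn0 => eq_swap eq_ups; apply: (addIn (etrans eq_swap _)); rewrite eq_ups.
Qed.

Lemma bad_pairs_invariant w : 0 < m ->
  all (fun x => 0 <= x.2)%R (labels 0 w) -> height w = 0%R ->
  bad_pairs (labels 0 w) =
  bad_pairs (labels 0 (nseq (count_mem true w) true ++ nseq (count_mem false w) false)).
Proof.
move=> m_gt0; have [N] := ubnP (inversions w); elim: N w => // N IHN w wN dyck hw.
have [<- //|[u [v ew]]] := sorted_or_descent w.
rewrite ew in wN dyck hw *.
have dyck' := dyck; rewrite labels_cat all_cat /= add0r in dyck'.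
have /and4P[du u0 un dv] := dyck'.
rewrite bad_pairs_swap //.
rewrite IHN.
- by rewrite !count_cat /= !add0n !add1n.
- rewrite -ltnS; apply: leq_trans wN; rewrite !ltnS.
  by elim: (u) => [|[] u' IHu] /=; rewrite ?count_cat /=; lia.
(* The only new vertex has rank [height u + m] instead of [height u - n]. *)
- rewrite labels_cat all_cat /= add0r du u0 /=.
  move: u0 un dv; rewrite /rise.
  have -> : (height u - n%:Z + m%:Z = height u + m%:Z - n%:Z)%R by lia.
  by move=> ? ? ->; lia.
- by move: hw; rewrite !height_cat !height_cons; lia.
Qed.


(** * Bad pairs against the sweep order and the diagonal *)

Lemma bad_pairs_nth x0 L :
  bad_pairs L = \sum_(0 <= i < size L) \sum_(0 <= j < size L)
    ((i < j) && bad_pair (nth x0 L i) (nth x0 L j)).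
Proof.
elim: L => [|x L IHL] /=; first by rewrite big_geq.
rewrite big_nat_recl // big_nat_recl //= add0n (count_nth x0); congr (_ + _).
by rewrite IHL; apply: eq_bigr => i _; rewrite big_nat_recl.
Qed.

Lemma bad_pairs_labels w :
  bad_pairs (labels 0 w) =
  \sum_(k <- iota 0 (size w) | is_step w false k)
    \sum_(l <- iota 0 (size w) | is_step w true l)
      ((k < l) && (srank m n w l + (m + n)%:Z <= srank m n w k)%R +
       (l < k) && (srank m n w l < srank m n w k)%R).
Proof.
rewrite (bad_pairs_nth (true, 0%R)) size_labels.
under [RHS]eq_bigr do rewrite big_split /=.
rewrite [RHS]big_split /=.
(* When the North step comes first, it must become the outer index, as in [bad_pairs_nth]. *)
rewrite [X in _ + X]exchange_big /=.
rewrite [X in X + _]big_mkcond [X in _ + X]big_mkcond -big_split /=.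
rewrite /index_iota subn0; apply: eq_big_seq => k; rewrite mem_iota => /= kw.
rewrite /is_step kw /=; case ek: (nth true w k) => /=.
  rewrite add0n [RHS]big_mkcond; apply: eq_big_seq => l; rewrite mem_iota => /= lw.
  rewrite !nth_labels // ek !add0r lw /=; case: (nth true w l) => //=.
  by rewrite andbF.
rewrite addn0 [RHS]big_mkcond; apply: eq_big_seq => l; rewrite mem_iota => /= lw.
rewrite !nth_labels // ek !add0r lw /=; case: (nth true w l) => //=.
by rewrite andbF.
Qed.

(** Equal ranks put [l] first only if [k < l], where [dinv] admits the difference 0; if [l < k] the
    inequality is strict, as in [bad_pair]. *)
Lemma sweep_inversionsE w d : 0 < m -> is_dyck_path m n d w ->
  \sum_(k <- iota 0 (size w) | is_step w false k)
    \sum_(l <- iota 0 (size w) | is_step w true l) sweep_le m n w l k =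
  dinv m n d w + bad_pairs (labels 0 w).
Proof.
move=> m_gt0 dyck; rewrite (dinvE dyck) bad_pairs_labels -big_split /=.
apply: eq_bigr => k /is_stepP[kw ek]; rewrite -big_split /=.
apply: eq_bigr => l /is_stepP[lw el].
rewrite (sweep_leE m_gt0 (ltnW lw) (ltnW kw)).
have kl : k != l by apply/eqP => e; move: el; rewrite -e ek.
move: (srank m n w k) (srank m n w l) => a b.
case: (ltngtP k l) kl => //= _ _; rewrite ?andbT ?andbF ?orbF ?addn0 ?add0n //.
case: (leP (b + (m + n)%:Z)%R a) => ab; lia.
Qed.

Lemma bad_pairs_sorted d :
  bad_pairs (labels 0 (nseq (d * n) true ++ nseq (d * m) false)) = cells_off d.
Proof.
set w := _ ++ _.
have cE : count_mem false w = d * m by rewrite count_cat !count_nseq /= mul0n mul1n.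
have cN : count_mem true w = d * n by rewrite count_cat !count_nseq /= mul0n mul1n addn0.
have sw : size w = d * n + d * m by rewrite size_cat !size_nseq.
rewrite bad_pairs_labels /cells_off.
have -> : iota 0 (d * m) = index_iota 0 (d * m) by rewrite /index_iota subn0.
(* The East step in column [i] of the sorted path starts at rank [n * (d * m - i)], so its bad pairs
   match the cells off the diagonal in the mirrored column. *)
rewrite big_nat_rev /= add0n /index_iota subn0.
have /= cells := sum_cells w (fun i j => ~~ weakly_above_diag m n (d * m - i.+1).+1 j).
rewrite cE cN in cells; rewrite {}cells.
apply: eq_bigr => k /is_stepP[kw ek]; apply: eq_bigr => l /is_stepP[lw el].
have kn : d * n <= k.
  by move: ek; rewrite nth_cat size_nseq; case: ltnP => // h; rewrite nth_nseq h.
have ln : l < d * n.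
  move: el; rewrite nth_cat size_nseq; case: ltnP => // h.
  by rewrite nth_nseq; case: ltnP => //; move: lw; rewrite sw; lia.
have vxl : vx w l = 0.
  by rewrite /vx take_cat size_nseq ln take_nseq 1?ltnW // count_nseq.
have vyl := vx_add_vy (ltnW lw); rewrite vxl add0n in vyl.
have vyk : vy w k = d * n.
  rewrite /vy take_cat size_nseq ltnNge kn /= count_cat take_nseq; last by lia.
  by rewrite !count_nseq /= mul1n mul0n addn0.
have vxk := vx_add_vy (ltnW kw); rewrite vyk in vxk.
rewrite /srank /vrank /weakly_above_diag vxl vyl vyk.
have -> : (k < l) = false by lia.
have -> : l < k by lia.
rewrite add0n /= -ltnNge subnSK; last by lia.
rewrite mulnBr; congr nat_of_bool.
have : n * vx w k <= n * (d * m) by rewrite leq_mul2l; apply/orP; right; lia.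
have e : m * (d * n) = n * (d * m) by rewrite mulnCA [RHS]mulnCA [n * m]mulnC.
rewrite -!PoszM e muln0; move: (n * vx w k) (m * l) (n * (d * m)) => x y z; lia.
Qed.

Lemma sweep_dyck d w : is_dyck_path m n d w -> is_dyck_path m n d (sweep m n w).
Proof.
move=> dyck; have [cE cN _] := dyck; split; rewrite ?count_sweep // => k _.
have := @sweep_srank_ge0 w k; rewrite -[w in height w]take_size -srank_height.
move=> /(_ (srank_size dyck)); rewrite /srank /vrank /weakly_above_diag; lia.
Qed.

End Ranks.

Theorem mainTheorem1 (m n d : nat) (hm : (0 < m)%N) (hn : (0 < n)%N)
    (hmn : coprime m n) (hd : (1 <= d)%N)
    (Dbar D : lattice_path) (hDbar : is_dyck_path m n d Dbar)
    (hD : D = sweep m n Dbar) :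
  dinv m n d Dbar = area m n d D.
Proof.
have [cE cN dyck] := hDbar.
(* Adding the constant to both sides avoids truncated subtraction. *)
apply: (@addIn (cells_off m n d)); rewrite hD.
rewrite (areaE (sweep_dyck hDbar)) sweep_inversions // (sweep_inversionsE hm hDbar).
rewrite bad_pairs_invariant //.
- by rewrite cE cN bad_pairs_sorted.
- apply/(all_nthP (true, 0%R)) => k; rewrite size_labels => kw.
  rewrite nth_labels // add0r /=.
  by have := dyck k (ltnW kw); rewrite /weakly_above_diag /srank /vrank; lia.
- by rewrite -[Dbar]take_size -srank_height (srank_size hDbar).
Qed.
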